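(* Every finite chordal bipartite graph $G$ with bipartition classes $U,W$ satisfies Frankl's conjecture: if $G$ has at least one edge, then each of $U$ and $W$ contains a vertex belonging to at most half of the maximal stable sets of $G$.
   Context: A chordal bipartite graph is a bipartite graph in which every cycle of length at least six has a chord. A set of vertices is stable if no two are adjacent; maximal means maximal under inclusion. (Edgeless graphs are considered to satisfy Frankl's conjecture trivially.) *)

(* Defs.v *)
From mathcomp Require Import all_boot.

Set Implicit Arguments.
Unset Strict Implicit.
Unset Printing Implicit Defensive.

Definition simple_graph (T : finType) (e : rel T) : Prop :=
  symmetric e /\ irreflexive e.

Section Graph.
Variables (T : finType) (e : rel T).

Definition stable (S : {set T}) : bool :=
  [forall x in S, forall y in S, ~~ e x y].

Definition max_stable : {set {set T}} := [set S | maxset stable S].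

Definition bipartition (U W : {set T}) : Prop :=
  [/\ U :|: W = [set: T], [disjoint U & W], stable U & stable W].

Definition bipartite : Prop := exists U W : {set T}, bipartition U W.

Definition chord (c : seq T) (x y : T) : bool :=
  [&& x \in c, y \in c, e x y, y != next c x & x != next c y].

Definition chordal_bipartite : Prop :=
  bipartite /\
  forall c : seq T, ucycle e c -> 6 <= size c -> exists x y : T, chord c x y.

Definition rare (v : T) : Prop :=
  2 * #|[set S in max_stable | v \in S]| <= #|max_stable|.

Definition satisfies_frankl (U W : {set T}) : Prop :=
  (exists x y : T, e x y) ->
  (exists2 u, u \in U & rare u) /\ (exists2 w, w \in W & rare w).

End Graph.

(* Main.v *)
Require Import Defs.
From mathcomp Require Import all_boot.

(* If [x z] is an edge and every vertex at distance two from [x] is adjacent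
   to [z], then [z] is rare: a maximal stable set containing [z] misses N(z),
   so dropping N(x) from it and completing on the side of [x] is injective and
   yields a maximal stable set that contains [x], hence not [z].

   Such an [x] exists on either side of a chordal bipartite graph with an edge.
   For a vertex [w], let C be a component of G - N(w) not containing [w] but
   meeting the side opposite to [w].  Since induced cycles have length four,
   some [w1] in C on the side of [w] is adjacent to all of N(C).  If [w1] is
   also adjacent to every vertex of C on the other side, any of those vertices
   will do; otherwise G - N(w1) has a suitable component strictly inside C. *)

Set Implicit Arguments.
Unset Strict Implicit.
Unset Printing Implicit Defensive.

Section Bipartite.

Variables (T : finType) (e : rel T) (U : {set T}).
Hypotheses (e_sym : symmetric e) (e_irr : irreflexive e).
Hypothesis e_bip : forall a b, e a b -> (a \in U) = (b \notin U).

(** * Maximal stable sets *)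

Lemma max_stableP (A : {set T}) :
  reflect (forall v, (v \in A) = [forall u in A, ~~ e v u])
          (A \in max_stable e).
Proof.
rewrite inE; apply: (iffP maxsetP) => [[stA maxA] v | defA].
  apply/idP/idP => [vA | /forall_inP nv].
    by apply: (forall_inP stA).
  rewrite -(maxA (v |: A)) ?setU11 ?subsetUr //.
  apply/forall_inP => a /setU1P[->|aA]; apply/forall_inP => b /setU1P[->|bA].
  - by rewrite e_irr.
  - exact: nv.
  - by rewrite e_sym nv.
  - by apply: (forall_inP (forall_inP stA a aA)).
split=> [|B stB sAB]; first by apply/forall_inP => a; rewrite defA.
apply/eqP; rewrite eqEsubset sAB andbT; apply/subsetP => v vB.
rewrite defA; apply/forall_inP => u uA.
exact: (forall_inP (forall_inP stB v vB) u (subsetP sAB u uA)).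
Qed.

(** * Exchanging [z] for its neighbour [x] *)

Section Swap.

Variables x z : T.

Definition same_side (v : T) : bool := (v \in U) == (x \in U).

(** The first clause takes the vertices on the side of [x] that have no neighbour left in [A] once
    N(x) is dropped. *)
Definition swap_in (A : {set T}) : {set T} :=
  [set v | if same_side v then [forall u in A, e v u ==> e x u]
           else (v \in A) && ~~ e x v].

Lemma same_side_edge a b : e a b -> same_side a = ~~ same_side b.
Proof. by rewrite /same_side => /e_bip ->; case: (b \in U) (x \in U) => [] []. Qed.

Lemma swap_in_max A : A \in max_stable e -> swap_in A \in max_stable e.
Proof.
move/max_stableP => defA; apply/max_stableP => v; rewrite inE.
case: ifP => cv.
  apply/forall_inP/forall_inP => [av u | av u uA].
    rewrite inE; apply: contraL => evu.
    have := same_side_edge evu; rewrite cv => /esym/negbTE ->.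
    by apply/negP => /andP[uA]; rewrite (implyP (av u uA) evu).
  apply/implyP => evu; apply: contraT => nxu.
  have cu : same_side u = false.
    by apply/negbTE; have := same_side_edge evu; rewrite cv => <-.
  by rewrite (negbTE (av u _)) // in evu; rewrite inE cu uA.
apply/andP/forall_inP => [[vA nxv] u | nv].
  rewrite inE; apply: contraL => evu; move: (same_side_edge evu).
  rewrite cv => /esym/negPn ->; apply/negP => /forall_inP/(_ v vA).
  by rewrite e_sym evu (negbTE nxv).
split; last first.
  (* [x] itself always lies in [swap_in A]. *)
  rewrite e_sym; apply: nv; rewrite inE /same_side eqxx.
  by apply/forall_inP => u _; apply/implyP.
rewrite defA; apply/forall_inP => u uA.
(* Being in [A], [u] has no neighbour in [A] at all, so it survives the swap. *)
apply/negP => evu; suff /nv : u \in swap_in A by rewrite evu.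
move: (same_side_edge evu); rewrite cv inE => /esym/negPn ->.
apply/forall_inP => y yA; apply/implyP => euy.
by move: uA; rewrite defA => /forall_inP/(_ y yA); rewrite euy.
Qed.

Hypothesis exz : e x z.
Hypothesis dom : forall y u, e x y -> e y u -> e z u.

(** A vertex added on this side has a neighbour in both [A] and N(x), so [dom] makes it adjacent to
    [z]; vertices of [A] are not, since [z] is in [A]. Removing N(z) thus undoes the completion. *)
Lemma mem_swap_in_side A v : A \in max_stable e -> z \in A -> same_side v ->
  (v \in A) = (v \in swap_in A) && ~~ e z v.
Proof.
move/max_stableP => defA zA cv; rewrite inE cv.
apply/idP/andP => [vA | [/forall_inP av nzv]].
  move: (vA); rewrite defA => /forall_inP nv; split.
    by apply/forall_inP => u uA; rewrite (negbTE (nv u uA)).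
  by rewrite e_sym nv.
rewrite defA; apply/forall_inP => u uA; apply: contra nzv => evu.
by apply: (dom (implyP (av u uA) evu)); rewrite e_sym.
Qed.

Lemma rare_dominating : rare e z.
Proof.
set M := max_stable e; pose Mz := [set A in M | z \in A].
have swap_inj : {in Mz &, injective swap_in}.
  move=> A B; rewrite inE => /andP[MA zA]; rewrite inE => /andP[MB zB] eqAB.
  have side v : same_side v -> (v \in A) = (v \in B).
    by move=> cv; rewrite (mem_swap_in_side MA zA cv) (mem_swap_in_side MB zB cv) eqAB.
  apply/setP => v; case cv: (same_side v); first exact: side.
  (* Off the side of [x], membership depends only on neighbours, which lie on that side. *)
  rewrite (max_stableP _ MA) (max_stableP _ MB).
  apply: eq_forallb => u; case evu: (e v u); last by rewrite !implybT.
  by rewrite side //; have := same_side_edge evu; rewrite cv => /esym/negPn.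
have sub : swap_in @: Mz \subset M :\: Mz.
  apply/subsetP => _ /imsetP[A AMz ->]; move: AMz; rewrite inE => /andP[MA zA].
  rewrite inE swap_in_max // andbT inE swap_in_max //= inE exz /= andbF.
  by rewrite -(negbK (same_side z)) -(same_side_edge exz) /same_side eqxx.
have := subset_leq_card sub; rewrite card_in_imset // => le.
rewrite /rare -/M -/Mz -(cardsID Mz M) mul2n -addnn leq_add //.
by rewrite subset_leq_card // subsetI subxx andbT; apply/subsetP => A; rewrite inE => /andP[].
Qed.

End Swap.

(** * Induced paths and short cycles *)

Hypothesis chordal :
  forall c : seq T, ucycle e c -> 6 <= size c -> exists x y, chord e c x y.

(** In a walk with fewest vertices, an edge skipping [p2] would give a shorter one. [w] serves as
    default for [head] and [last]. *)
Lemma induced_walk w s t (l : seq T) :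
  sorted e (s :: l) -> last s l = t ->
  exists m : seq T, [/\ sorted e m, uniq m, head w m = s, last w m = t &
    {subset m <= s :: l} /\ forall p1 a p2 b p3,
      m = p1 ++ a :: p2 ++ b :: p3 -> e a b -> p2 = [::]].
Proof.
move=> sl ll.
pose P n := [exists m : n.-tuple T, [&& sorted e m, uniq m, head w m == s,
  last w m == t & all [in s :: l] m]].
have PE (m : seq T) : sorted e m -> uniq m -> head w m = s -> last w m = t ->
    {subset m <= s :: l} -> P (size m).
  move=> m1 m2 m3 m4 m5; apply/existsP; exists (in_tuple m).
  by rewrite /= m1 m2 m3 m4 !eqxx; apply/allP.
have exP : exists n, P n.
  case/shortenP: sl ll => m pm um subm lm; exists (size m).+1.
  apply: (PE (s :: m)) => // v; rewrite !inE => /orP[->//|/subm ->].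
  by rewrite orbT.
case: (ex_minnP exP) => n /existsP[[m /= /eqP sz]].
move=> /and5P[sm um /eqP hm /eqP lm /allP subm] minn.
exists m; split=> //; split=> // p1 a p2 b p3 mE eab.
have sub : subseq (p1 ++ a :: b :: p3) m.
  by rewrite mE cat_subseq //= eqxx suffix_subseq // suffix_suffix.
have : n <= size (p1 ++ a :: b :: p3).
  apply/minn/PE.
  - move: sm; rewrite mE; case: p1 {sub mE} => [|c p1] /=.
      by rewrite cat_path /= eab => /and3P[].
    by rewrite !cat_path /= cat_path /= eab => /and5P[-> -> _ _ ->].
  - exact: subseq_uniq um.
  - by rewrite -hm mE; case: (p1).
  - by rewrite -lm mE !last_cat /= last_cat.
  - by move=> v /(mem_subseq sub)/subm.
rewrite -sz mE !size_cat /= size_cat leq_add2l !ltnS /= addnS ltnS.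
by rewrite -[X in _ <= X]add0n leq_add2r leqn0 => /nilP.
Qed.

(** Closing a shortest walk through [w] gives a chordless cycle, so one of length below six; by
    parity it has length four, and the walk a single inner vertex. *)
Lemma chordal_common_neighbour w s t (l : seq T) :
  e w s -> e w t -> s != t -> sorted e (s :: l) -> last s l = t ->
  w \notin s :: l -> (forall v, v \in s :: l -> e w v -> v = s \/ v = t) ->
  exists2 v, v \in s :: l & e s v && e v t.
Proof.
move=> ews ewt nst sl ll wl nl.
have [m [sm um hm lm [subm ind]]] := induced_walk w sl ll.
have wm : w \notin m by apply: contra wl => /subm.
have tm : t \in m.
  rewrite -lm; case: m hm {sm um lm subm ind wm} => [ws|a m _] /=.
    by rewrite -ws e_irr in ews.
  exact: mem_last.
have cyc : ucycle e (w :: m).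
  rewrite /ucycle /= wm um !andbT rcons_path lm e_sym ewt andbT.
  by case: m hm sm {um lm subm ind wm tm} => //= a m ->; rewrite ews.
have col : (s \in U) = (t \in U) by rewrite -(negbK (s \in U)) -(e_bip ews) (e_bip ewt) negbK.
(* An edge with both ends on [m] joins consecutive vertices. *)
have nchord x y : x \in m -> y \in m -> e x y -> index x m < index y m ->
    y != next (w :: m) x -> False.
  move=> xm ym exy lt; case/splitPr: xm um wm ind lt ym => p1 p2 um wm ind lt ym.
  have xp1 : x \notin p1.
    by move: um; rewrite cat_uniq /= => /and3P[_ /norP[]].
  have {ym} : y \in p2.
    move: lt ym; rewrite !index_cat (negbTE xp1) /= eqxx addn0 mem_cat inE.
    case: ifP => [yp1|_ _ /=]; last by case: eqP => // yx; rewrite yx e_irr in exy.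
    by rewrite ltnNge index_size.
  move=> yp2; case/splitPr: yp2 ind um wm {lt} => p3 p4 ind um wm.
  have p3E := ind _ _ _ _ _ erefl exy; rewrite next_nth inE mem_cat mem_head !orbT.
  have xw : (w == x) = false.
    by apply: contraNF wm => /eqP ->; rewrite mem_cat mem_head orbT.
  rewrite /= xw index_cat (negbTE xp1) /= eqxx addn0 p3E /=.
  by rewrite nth_cat ltnNge leqnSn /= subSnn eqxx.
have [le6|/chordal] := ltnP (size (w :: m)) 6; last first.
  case/(_ cyc) => x [y] /and5P[]; rewrite !inE => xm ym exy nyx nxy.
  (* An edge from [w] to [m] ends in [s] or [t], the neighbours of [w] on the cycle. *)
  exfalso; have nw u v : e u v -> u == w -> v \in m -> v != next (w :: m) u ->
      u != next (w :: m) v -> False.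
    move=> euv /eqP uw vm; rewrite {}uw in euv *.
    case: (nl v (subm v vm) euv) => -> {euv}.
      by case: (m) hm => [|a m'] /= ->; rewrite !eqxx.
    move=> _; rewrite next_nth inE tm orbT /=; case: (w =P t) => [wt|_].
      by rewrite wt e_irr in ewt.
    case: (m) hm lm um => [|a m'] hm lm um.
      by rewrite -hm e_irr in ews.
    (* [t] comes last, so [next] returns its default, the head [w]. *)
    by rewrite -lm (index_last um) nth_default /= ?eqxx.
  case/orP: (xm) => [xw|{}xm].
    apply: (nw x y) => //; case/orP: ym => // /eqP yw.
    by rewrite yw (eqP xw) e_irr in exy.
  case/orP: (ym) => [yw|{}ym]; first by apply: (nw y x) => //; rewrite e_sym.
  have [lt|lt|eqi] := ltngtP (index x m) (index y m).
  - exact: nchord exy lt nyx.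
  - by apply: nchord lt nxy => //; rewrite e_sym.
  - by rewrite -(nth_index w xm) eqi nth_index // e_irr in exy.
case: m sm um hm lm subm le6 {tm ind wm cyc nchord} => [|a m] /=.
  by move=> _ _ ws; rewrite -ws e_irr in ews.
move=> sm _ aE; rewrite {a}aE in sm * => lm subm.
(* Paths on two or four vertices contradict [col]. *)
case: m sm lm subm => [_ /= st|v1 [|v2 [|v3 [|v4 m]]]] //=; first by rewrite st eqxx in nst.
- by move=> /andP[/e_bip + _] v1E; rewrite v1E col; case: (t \in U).
- move=> /and3P[e1 e2 _] v2E subm _; rewrite v2E in e2.
  by exists v1; rewrite ?e1 // subm // !inE eqxx orbT.
- move=> /and4P[/e_bip + /e_bip + /e_bip + _] v3E; rewrite v3E col.
  by case: (t \in U) (v1 \in U) (v2 \in U) => [] [] [].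
Qed.

(** * Components of G - N(w) *)

Definition avoiding (w : T) : rel T :=
  [rel a b | [&& e a b, ~~ e w a & ~~ e w b]].

Lemma avoiding_sym w : symmetric (avoiding w).
Proof. by move=> a b; rewrite /avoiding /= e_sym [X in _ && X]andbC. Qed.

Lemma connect_invariant (r : rel T) (P : pred T) a b :
  (forall c d, P c -> r c d -> P d) -> P a -> connect r a b -> P b.
Proof.
move=> step Pa /connectP[p pp ->]; elim: p a Pa pp => //= c p IH a Pa.
by case/andP => rac; apply: IH; apply: step rac.
Qed.

(** Choose [w1] in the component, on the side of [w], with most neighbours in N(w). If it missed
    one, a walk from [w1] would have a first vertex [w2] with a neighbour [s2] in N(w) outside
    N(w1); a common neighbour on the walk then contradicts that choice. *)
Lemma component_dominating_neighbour w x y :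
  ~~ e w x -> e x y -> (w \in U) != (x \in U) ->
  exists w1, [/\ connect (avoiding w) x w1, (w1 \in U) = (w \in U) &
    forall v s, connect (avoiding w) x v -> e w s -> e v s -> e w1 s].
Proof.
move=> nwx exy cwx; set C := connect (avoiding w) x.
have yU : (y \in U) = (w \in U).
  by move: cwx (e_bip exy); case: (w \in U) (x \in U) (y \in U) => [] [] [].
have nwy : ~~ e w y by apply/negP => /e_bip; rewrite yU; case: (w \in U).
have Cy : C y by apply: connect1; rewrite /avoiding /= exy nwx.
have Cw v : C v -> ~~ e w v && (v != w).
  apply: (connect_invariant (P := fun v => ~~ e w v && (v != w))) => [c d _|].
    case/and3P=> ecd nc nd; rewrite nd; apply: contra nc => /eqP <-.
    by rewrite e_sym.
  by rewrite nwx; apply: contraNneq cwx => ->.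
pose N v := [set s | e w s && e v s].
have Py : C y && ((y \in U) == (w \in U)) by rewrite Cy yU eqxx.
case: (arg_maxnP (P := fun v => C v && ((v \in U) == (w \in U)))
                 (fun v => #|N v|) Py) => w1 /andP[Cw1 /eqP w1U] maxw1.
exists w1; split=> // v s Cv ews evs; apply: contraT => nw1s; exfalso.
pose bad v := [exists s, [&& e w s, e v s & ~~ e w1 s]].
have bad_v : bad v by apply/existsP; exists s; rewrite ews evs.
have /connectP[p pp vE] : connect (avoiding w) w1 v.
  by apply: connect_trans Cv; rewrite (sym_connect_sym (@avoiding_sym w)).
have Cp u : u \in w1 :: p -> C u.
  by move=> up; apply: connect_trans Cw1 _; apply: (path_connect pp).
have : has bad (w1 :: p) by apply/hasP; exists v => //; rewrite vE mem_last.
have {pp} : sorted e (w1 :: p).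
  by apply: sub_path pp => a b /and3P[].
move: Cp {vE}; set q := w1 :: p; have hq : head w q = w1 by [].
move=> + + hbad; move: hq; case/split_find: hbad => w2 p1 p2 bad_w2 nbad.
case/existsP: (bad_w2) => s2 /and3P[ews2 ew2s2 nw1s2] hq Cp sq.
have w2U : (w2 \in U) = (w \in U) by rewrite (e_bip ew2s2) (e_bip ews2).
have Cw2 : C w2 by apply: Cp; rewrite mem_cat mem_rcons mem_head.
(* Maximality of [w1] yields [s1] in N(w) adjacent to [w1] but not to [w2]. *)
have /subsetPn[s1] : ~~ (N w1 \subset N w2).
  apply/negP => sub; have : N w1 \proper N w2.
    rewrite properE sub; apply/subsetPn; exists s2.
      by rewrite inE ews2.
    by rewrite inE ews2.
  move/proper_card; rewrite ltnNge; case/negP; apply: maxw1.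
  by rewrite Cw2 w2U eqxx.
rewrite !inE => /andP[ews1 ew1s1]; rewrite ews1 /= => nw2s1.
case: p1 nbad hq Cp sq => [|a p1] nbad /= hq Cp.
  by case/existsP: bad_w2 => u /and3P[_]; rewrite hq => ->.
rewrite {a}hq in nbad Cp *; rewrite cat_path => /andP[sq _].
set l := w1 :: rcons (rcons p1 w2) s2.
have lP u : u \in s1 :: l -> [\/ u = s1, u = s2 | u \in rcons (w1 :: p1) w2].
  rewrite inE /l -rcons_cons mem_rcons inE => /or3P[/eqP->|/eqP->|ul].
  - by constructor 1.
  - by constructor 2.
  - by constructor 3.
have Cl u : u \in rcons (w1 :: p1) w2 -> ~~ e w u && (u != w).
  by move=> ul; apply/Cw/Cp; rewrite -cat_cons mem_cat; apply/orP; left.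
case: (@chordal_common_neighbour w s1 s2 l) => //.
- by apply: contraNneq nw1s2 => <-.
- by rewrite /= e_sym ew1s1 rcons_path sq last_rcons.
- by rewrite /= last_rcons.
- apply/negP => /lP[ws|ws|/Cl]; last by rewrite eqxx andbF.
    by rewrite -ws e_irr in ews1.
  by rewrite -ws e_irr in ews2.
- move=> u /lP[-> _|-> _|/Cl/andP[/negbTE->]] //; by [left|right].
(* The common neighbour of [s1] and [s2] is not [w2], so it is an earlier bad vertex. *)
move=> u /lP[->|->|]; rewrite ?e_irr ?andbF //.
rewrite mem_rcons inE => /orP[/eqP->|ul] /andP[es1u eus2].
  by rewrite e_sym (negbTE nw2s1) in es1u.
case/hasP: nbad; exists u => //.
by apply/existsP; exists s2; rewrite ews2 eus2.
Qed.

Lemma exists_dominated w x y : ~~ e w x -> e x y -> (w \in U) != (x \in U) ->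
  exists x' z, [/\ (x' \in U) = (x \in U), e x' z &
    forall y' u, e x' y' -> e y' u -> e z u].
Proof.
have [n] := ubnP #|connect (avoiding w) x|.
elim: n w x y => // n IH w x y /ltnSE len nwx exy cwx.
have [w1 [Cw1 w1U dom]] := component_dominating_neighbour nwx exy cwx.
set C := connect (avoiding w) x in len Cw1 dom.
(* The second conjunct supplies the edge at [u] that [IH] asks for. *)
have Cprop v : C v -> ~~ e w v && [exists u, e v u].
  apply: (connect_invariant (P := fun v => ~~ e w v && [exists u, e v u])).
    move=> c d _ /and3P[ecd _ ->]; apply/existsP; exists c.
    by rewrite e_sym.
  by rewrite nwx; apply/existsP; exists y.
have [/existsP[u /and3P[Cu uU nw1u]]|] :=
  boolP [exists u, [&& C u, (u \in U) == (x \in U) & ~~ e w1 u]].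
  have /andP[_ /existsP[v euv]] := Cprop u Cu.
  have cw1u : (w1 \in U) != (u \in U) by rewrite w1U (eqP uU).
  have [|x' [z [x'U exz dz]]] := IH w1 u v _ nw1u euv cw1u; last first.
    by exists x', z; rewrite x'U (eqP uU).
  apply: leq_trans len; apply: proper_card; apply/properP; split.
    (* Leaving [C] means entering N(w), hence N(w1) by [dom]. *)
    apply/subsetP => b Cb; rewrite unfold_in.
    apply: connect_invariant Cu Cb => c d Cc /and3P[ecd nw1c nw1d].
    have /andP[nwc _] := Cprop c Cc; apply: (connect_trans Cc (connect1 _)).
    rewrite /avoiding /= ecd nwc; apply: contra nw1d => ewd.
    exact: dom Cc ewd ecd.
  (* [w1] lies in [C] but is isolated in G - N(w1). *)
  exists w1 => //; rewrite unfold_in; apply/negP => Cuw1.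
  suff : w1 != w1 by rewrite eqxx.
  apply: (connect_invariant (P := fun v => v != w1)) Cuw1 => [c d _|].
    by case/and3P=> ecd nc _; apply: contra nc => /eqP <-; rewrite e_sym.
  by apply: contraNneq cw1u => ->.
rewrite negb_exists => /forallP all1.
have {}all1 u : C u -> (u \in U) = (x \in U) -> e w1 u.
  by move=> Cu uU; apply: contraT => nu; have := all1 u; rewrite Cu uU eqxx nu.
have Cx : C x by apply: connect0.
exists x, w1; split=> //; first by rewrite e_sym all1.
move=> y' u exy' ey'u.
have y'U : (y' \in U) = (w \in U).
  by move: cwx (e_bip exy'); case: (w \in U) (x \in U) (y' \in U) => [] [] [].
have nwy' : ~~ e w y' by apply/negP => /e_bip; rewrite y'U; case: (w \in U).
have Cy' : C y' by apply: connect1; rewrite /avoiding /= exy' nwx.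
(* Either [u] is in N(w), or it lies in [C] on the side of [x]. *)
have [ewu|nwu] := boolP (e w u); first exact: (dom y').
apply: all1; first by apply: connect_trans Cy' (connect1 _); rewrite /avoiding /= ey'u nwy'.
by move: (e_bip exy') (e_bip ey'u) => -> ->; rewrite negbK.
Qed.

Lemma exists_rare w x : e w x -> exists2 z, (z \in U) = (w \in U) & rare e z.
Proof.
move=> ewx; have exw : e x w by rewrite e_sym.
suff [x' [z [x'U exz dom]]] : exists x' z, [/\ (x' \in U) = (x \in U), e x' z &
    forall y' u, e x' y' -> e y' u -> e z u].
  exists z; last exact: rare_dominating exz dom.
  by rewrite (e_bip ewx) -x'U (e_bip exz) negbK.
(* A non-isolated vertex opposite [w] outside N(w) starts the descent; without one, the pair [x],
   [w] already works. *)
have [/existsP[u /and3P[nwu uU /existsP[v euv]]]|] :=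
  boolP [exists u, [&& ~~ e w u, (u \in U) == (x \in U) & [exists v, e u v]]].
  have [|x' [z [x'U exz dom]]] := exists_dominated nwu euv.
    by rewrite (eqP uU) (e_bip ewx); case: (x \in U).
  by exists x', z; rewrite x'U (eqP uU).
rewrite negb_exists => /forallP all1; exists x, w; split=> // y u exy eyu.
apply: contraT => nwu; have := all1 u; rewrite nwu (e_bip exy) (e_bip eyu) negbK eqxx.
by case/negP; apply/existsP; exists y; rewrite e_sym.
Qed.

End Bipartite.

Theorem theorem9 (T : finType) (e : rel T) (U W : {set T}) :
  simple_graph e -> bipartition e U W -> chordal_bipartite e ->
  satisfies_frankl e U W.
Proof.
move=> [e_sym e_irr] [UW dUW stU stW] [_ chordal] [x [y exy]].
have WE v : (v \in W) = (v \notin U).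
  have := in_setT v; rewrite -UW inE; case vU: (v \in U) => //= _.
  exact: (disjointFr dUW).
have e_bip a b : e a b -> (a \in U) = (b \notin U).
  move=> eab; case aU: (a \in U); case bU: (b \in U) => //=.
    by have /forall_inP/(_ b bU) := forall_inP stU a aU; rewrite eab.
  have aW : a \in W by rewrite WE aU.
  have bW : b \in W by rewrite WE bU.
  by have /forall_inP/(_ b bW) := forall_inP stW a aW; rewrite eab.
(* The two orientations of one edge serve the two sides. *)
have [z zU rz] := exists_rare e_sym e_irr e_bip chordal exy.
have [|z' z'U rz'] := exists_rare e_sym e_irr e_bip chordal (w := y) (x := x).
  by rewrite e_sym.
have xy := e_bip _ _ exy.
case xU: (x \in U) in xy zU; split.
- by exists z.
- by exists z' => //; rewrite WE z'U -xy.
- by exists z' => //; rewrite z'U -(negbK (y \in U)) -xy.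
- by exists z => //; rewrite WE zU.
Qed.
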